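(* Let $n\ge1$ and $\hbar>0$. With $\mathcal G_F^{bs}(\mathbb{CP}_n,\pi_0)$ and $\mathfrak T_n$ the topological groupoids defined in the context, the map $\Phi:\mathcal G_F^{bs}(\mathbb{CP}_n,\pi_0)\to\mathfrak T_n$, $$\Phi(c,h)=(p_1,p_2-p_1,\dots,p_n-p_{n-1};\,q_1,q_2-q_1,\dots,q_n-q_{n-1})^\sim,\qquad c_i=1-e^{-\hbar q_i},\quad h_i=\hbar p_i,$$ is an isomorphism of topological groupoids.
   Context: Let $\overline{\mathbb Z}=\mathbb Z\cup\{\infty\}$ and $\overline{\mathbb N}=\mathbb N\cup\{\infty\}$ ($0\in\mathbb N$) be topologized so that finite points are isolated and neighbourhoods of $\infty$ contain all sufficiently large integers (so $\overline{\mathbb N}$ is the one-point compactification); $e^{-\hbar\infty}=0$. **$\mathcal G_F^{bs}(\mathbb{CP}_n,\pi_0)$** (the groupoid of Bohr-Sommerfeld leaves for the standard Poisson structure on $\mathbb{CP}_n$): let $\Delta_n=\{c\in\mathbb R^n:0\le c_1\le\dots\le c_n\le1\}$ and $r(c,h)_i=1+e^{-h_i}(c_i-1)$. It is the set of $(c,h)\in\mathbb R^n\times\mathbb R^n$ with $c\in\Delta_n$, $r(c,h)\in\Delta_n$, $h_i\in\hbar\mathbb Z$ for all $i$, $\log(1-c_i)\in\hbar\mathbb Z$ whenever $c_i\ne1$, and $h_i=0$ whenever $c_i=1$. Source $c$, target $r(c,h)$, product $(c,h)(r(c,h),h')=(c,h+h')$, subspace topology. **$\mathfrak T_n$** (Sheu's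 groupoid): $\mathbb Z^n$ acts on $\overline{\mathbb Z}^n$ by translation, trivially on infinite coordinates. Let $\mathcal T_n=\{(j;k)\in\mathbb Z^n\times\overline{\mathbb Z}^n: k_i\ge0,\ j_i+k_i\ge0\}$ be the action groupoid restricted to $\overline{\mathbb N}^n$ (source $k$, target $k+j$, product $(j;k)(j';k+j)=(j+j';k)$). Let $\tilde{\mathcal T}_n\subset\mathcal T_n$ be the subgroupoid of $(j;k)$ such that $k_i=\infty$ implies $\sum_{m=1}^ij_m=0$ and $j_l=0$ for all $l\ge i+1$. Let $\mathfrak T_n=\tilde{\mathcal T}_n/\sim$ (quotient topology and induced groupoid structure), where $(j;k)\sim(j;k_1,\dots,k_{i-1},\infty,\dots,\infty)$ if $k_i=\infty$; $(j;k)^\sim$ denotes the class. In the formula for $\Phi$, if $i$ is the first index with $q_i=\infty$, the entries $q_l-q_{l-1}=\infty-\infty$ with $l>i$ may be given any value, since they do not affect the equivalence class. *)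

(* Defs.v *)
From HB Require Import structures.
From Stdlib Require Import Relations.
From mathcomp Require Import all_boot all_order all_algebra.
From mathcomp Require Import all_classical all_reals all_analysis.
From mathcomp Require Import zify ring lra.
Import Order.TTheory GRing.Theory Num.Theory.
Import numFieldNormedType.Exports.

Set Implicit Arguments.
Unset Strict Implicit.
Unset Printing Implicit Defensive.

Local Open Scope classical_set_scope.
Local Open Scope ring_scope.
Local Open Scope quotient_scope.

(* Arrows compose left to right: [mul f g] is the product of [f] and [g] when
   [tgt f = src g], and is meaningless otherwise. *)
Record groupoid_laws (ob arr : Type) (src tgt : arr -> ob) (idt : ob -> arr)
    (inv : arr -> arr) (mul : arr -> arr -> arr) : Prop := GroupoidLaws {
  src_idt : forall a, src (idt a) = a;
  tgt_idt : forall a, tgt (idt a) = a;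
  src_inv : forall f, src (inv f) = tgt f;
  tgt_inv : forall f, tgt (inv f) = src f;
  src_mul : forall f g, tgt f = src g -> src (mul f g) = src f;
  tgt_mul : forall f g, tgt f = src g -> tgt (mul f g) = tgt g;
  mul_assoc : forall f g h, tgt f = src g -> tgt g = src h ->
    mul f (mul g h) = mul (mul f g) h;
  mul_idl : forall f, mul (idt (src f)) f = f;
  mul_idr : forall f, mul f (idt (tgt f)) = f;
  mul_invr : forall f, mul f (inv f) = idt (src f);
  mul_invl : forall f, mul (inv f) f = idt (tgt f) }.

Record groupoid := Groupoid {
  ob : topologicalType;
  arr : topologicalType;
  src : arr -> ob;
  tgt : arr -> ob;
  idt : ob -> arr;
  inv : arr -> arr;
  mul : arr -> arr -> arr;
  laws : groupoid_laws src tgt idt inv mul }.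

Arguments src {_}.
Arguments tgt {_}.
Arguments idt {_}.
Arguments inv {_}.
Arguments mul {_}.

Definition composable (G : groupoid) : set (arr G * arr G) :=
  [set fg | tgt fg.1 = src fg.2].

Record is_topological (G : groupoid) : Prop := IsTopological {
  src_continuous : continuous (@src G);
  tgt_continuous : continuous (@tgt G);
  idt_continuous : continuous (@idt G);
  inv_continuous : continuous (@inv G);
  mul_continuous :
    {within @composable G,
      continuous (fun fg : arr G * arr G => mul fg.1 fg.2)} }.

Definition homeomorphism (X Y : topologicalType) (f : X -> Y) : Prop :=
  continuous f /\
  exists g : Y -> X, [/\ cancel f g, cancel g f & continuous g].

Record is_functor (G H : groupoid) (F0 : ob G -> ob H) (F : arr G -> arr H)
    : Prop := IsFunctor {
  functor_src : forall f, src (F f) = F0 (src f);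
  functor_tgt : forall f, tgt (F f) = F0 (tgt f);
  functor_idt : forall a, F (idt a) = idt (F0 a);
  functor_mul : forall f g, tgt f = src g -> F (mul f g) = mul (F f) (F g) }.

Definition is_topological_groupoid_iso (G H : groupoid) (F : arr G -> arr H)
    : Prop :=
  [/\ is_topological G, is_topological H &
      exists F0 : ob G -> ob H,
        [/\ is_functor F0 F, homeomorphism F0 & homeomorphism F]].

Section GeneratedQuotient.
Variables (T : topologicalType) (step : T -> T -> Prop).

Definition generated (x y : T) : bool := `[< clos_refl_sym_trans T step x y >].

Lemma generated_refl : reflexive generated.
Proof. by move=> x; apply/asboolP; exact: rst_refl. Qed.

Lemma generated_sym : symmetric generated.
Proof. by move=> x y; apply/asboolP/asboolP; exact: rst_sym. Qed.

Lemma generated_trans : transitive generated.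
Proof.
by move=> y x z /asboolP xy /asboolP yz; apply/asboolP; exact: rst_trans xy yz.
Qed.

Canonical generated_equiv :=
  EquivRel generated generated_refl generated_sym generated_trans.

Definition generated_quotient : topologicalType :=
  quotient_topology {eq_quot generated_equiv}.

Definition class (x : T) : generated_quotient :=
  \pi_(quotient_topology {eq_quot generated_equiv}) x.

Definition rep (a : generated_quotient) : T :=
  repr (a : quotient_topology {eq_quot generated_equiv}).

Lemma repK : cancel rep class.
Proof. by move=> a; rewrite /class /rep reprK. Qed.

Lemma classP x y : class x = class y <-> clos_refl_sym_trans T step x y.
Proof.
split=> [/(@eqmodP _ generated_equiv) /asboolP //|xy].
by apply/(@eqmodP _ generated_equiv)/asboolP.
Qed.

End GeneratedQuotient.

Arguments class {T step}.
Arguments rep {T step}.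

(* Independent of the choice of [rep] when [f] maps [s] to [s']: see
   [induced_class]. *)
Definition induced (T U : topologicalType) (s : T -> T -> Prop)
    (s' : U -> U -> Prop) (f : T -> U) (a : generated_quotient s)
    : generated_quotient s' := class (f (rep a)).

Arguments induced {T U s s'} f a.

Lemma induced_class (T U : topologicalType) (s : T -> T -> Prop)
    (s' : U -> U -> Prop) (f : T -> U) :
  (forall x y, s x y -> s' (f x) (f y)) ->
  forall x, @induced T U s s' f (class x) = class (f x).
Proof.
move=> sf x; rewrite /induced; apply/classP.
have /classP : class (rep (class x : generated_quotient s)) =
  class x :> generated_quotient s by rewrite repK.
move: (rep _) => x'.
elim=> [y z /sf|y|y z _|y z t _ + _].
- exact: rst_step.
- exact: rst_refl.
- exact: rst_sym.
- exact: rst_trans.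
Qed.

HB.instance Definition _ := hasNbhs.Build int principal_filter.
HB.instance Definition _ := Discrete_ofNbhs.Build int erefl.

(* [None] stands for +oo. *)
Definition Zbar := option int.
HB.instance Definition _ := Choice.on Zbar.

Definition Zbar_open (U : set Zbar) : Prop :=
  U None -> exists N : int, forall m : int, N <= m -> U (Some m).

Lemma Zbar_openT : Zbar_open setT.
Proof. by move=> _; exists 0. Qed.

Lemma Zbar_openI (U V : set Zbar) :
  Zbar_open U -> Zbar_open V -> Zbar_open (U `&` V).
Proof.
move=> oU oV [/oU[N NU] /oV[M MV]]; exists (Num.max N M) => m.
by rewrite ge_max => /andP[? ?]; split; [exact: NU|exact: MV].
Qed.

Lemma Zbar_open_bigU (I : Type) (F : I -> set Zbar) :
  (forall i, Zbar_open (F i)) -> Zbar_open (\bigcup_i F i).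
Proof.
move=> oF [i _ /oF[N NF]]; exists N => m Nm; exists i => //; exact: NF.
Qed.

HB.instance Definition _ :=
  isOpenTopological.Build Zbar Zbar_openT Zbar_openI Zbar_open_bigU.

Definition Zbar_ge0 (k : Zbar) : bool := if k is Some m then 0 <= m else true.

Definition Zbar_add (j : int) (k : Zbar) : Zbar := omap (fun m => j + m) k.

(* oo - oo is set to oo; finite - oo never occurs below. *)
Definition Zbar_sub (k l : Zbar) : Zbar :=
  match k, l with Some a, Some b => Some (a - b) | _, _ => None end.

(* e^(- hbar q), with e^(- hbar oo) = 0 *)
Definition expNZ (R : realType) (hbar : R) (q : Zbar) : R :=
  if q is Some m then expR (- (hbar * m%:~R)) else 0.

Section BohrSommerfeld.
Variables (R : realType) (n : nat) (hbar : R).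
Implicit Types c h : 'rV[R]_n.

Definition Delta : set 'rV[R]_n :=
  [set c | (forall i, 0 <= c 0 i <= 1) /\
           (forall i l : 'I_n, (i <= l)%N -> c 0 i <= c 0 l)].

(* r(c, h). *)
Definition dress c h : 'rV[R]_n := \row_i (1 + expR (- h 0 i) * (c 0 i - 1)).

Definition in_hbarZ (x : R) : Prop := exists m : int, x = hbar * m%:~R.

(* The units (c, 0). *)
Definition bs_ob : set 'rV[R]_n :=
  [set c | Delta c /\ forall i, c 0 i <> 1 -> in_hbarZ (ln (1 - c 0 i))].

Definition bs_arr : set ('rV[R]_n * 'rV[R]_n) :=
  [set x | [/\ Delta x.1,
               Delta (dress x.1 x.2),
               forall i, in_hbarZ (x.2 0 i),
               forall i, x.1 0 i <> 1 -> in_hbarZ (ln (1 - x.1 0 i)) &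
               forall i, x.1 0 i = 1 -> x.2 0 i = 0]].

Lemma dress0 c : dress c 0 = c.
Proof. by apply/rowP => i; rewrite !mxE oppr0 expR0 mul1r addrC subrK. Qed.

Lemma dressD c h h' : dress (dress c h) h' = dress c (h + h').
Proof. by apply/rowP => i; rewrite !mxE opprD expRD; ring. Qed.

Lemma dressB c h i : 1 - dress c h 0 i = expR (- h 0 i) * (1 - c 0 i).
Proof. by rewrite !mxE; ring. Qed.

Lemma dress1 c h i : dress c h 0 i = 1 <-> c 0 i = 1.
Proof.
split=> [E|E]; last by rewrite !mxE E; ring.
have := dressB c h i; rewrite E subrr => /esym/eqP.
rewrite mulf_eq0 gt_eqF ?expR_gt0 //= subr_eq0 => /eqP //.
Qed.

Lemma in_hbarZ0 : in_hbarZ 0.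
Proof. by exists 0; rewrite mulr0. Qed.

Lemma in_hbarZN x : in_hbarZ x -> in_hbarZ (- x).
Proof. by move=> [m ->]; exists (- m); rewrite mulrNz mulrN. Qed.

Lemma in_hbarZD x y : in_hbarZ x -> in_hbarZ y -> in_hbarZ (x + y).
Proof. by move=> [m ->] [m' ->]; exists (m + m'); rewrite intrD mulrDr. Qed.

Lemma Delta_lt1 c i : Delta c -> c 0 i <> 1 -> 0 < 1 - c 0 i.
Proof.
move=> [/(_ i)/andP[_ le1] _] /eqP ne1.
by rewrite subr_gt0 lt_neqAle ne1.
Qed.

Lemma bs_srcP x : bs_arr x -> bs_ob x.1.
Proof. by case=> ? ? ? ? ?; split. Qed.

Lemma bs_tgtP x : bs_arr x -> bs_ob (dress x.1 x.2).
Proof.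
case: x => c h /= [Dc Dr hZ cZ h0]; split=> // i ri.
have ci : c 0 i <> 1 by move=> /dress1 -/(_ h).
rewrite dressB lnM ?posrE ?expR_gt0 ?Delta_lt1 // expRK.
by apply: in_hbarZD; [exact: in_hbarZN|exact: cZ].
Qed.

Lemma bs_idtP c : bs_ob c -> bs_arr (c, 0).
Proof.
move=> [Dc cZ]; split=> //=; first by rewrite dress0.
  by move=> i; rewrite mxE; exact: in_hbarZ0.
by move=> i _; rewrite mxE.
Qed.

Lemma bs_invP x : bs_arr x -> bs_arr (dress x.1 x.2, - x.2).
Proof.
move=> Ax; have [_ rZ] := bs_tgtP Ax; case: Ax => Dc Dr hZ cZ h0.
split=> //=; first by rewrite dressD subrr dress0.
  by move=> i; rewrite mxE; exact: in_hbarZN.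
by move=> i /dress1/h0; rewrite mxE => ->; rewrite oppr0.
Qed.

Lemma bs_mulP x y : bs_arr x -> bs_arr y -> dress x.1 x.2 = y.1 ->
  bs_arr (x.1, x.2 + y.2).
Proof.
case: x y => [c h] [c' h'] [/= Dc Dr hZ cZ h0] + /= E.
rewrite -{c'}E => -[/= _ Dr' hZ' _ h0'].
split=> //=; first by rewrite -dressD.
  by move=> i; rewrite mxE; exact: in_hbarZD.
by move=> i c1; rewrite mxE h0 // h0' ?addr0 //; apply/dress1.
Qed.

Definition bs_src (x : bs_arr) : bs_ob :=
  SigSub (mem_set (bs_srcP (set_valP x))).
Definition bs_tgt (x : bs_arr) : bs_ob :=
  SigSub (mem_set (bs_tgtP (set_valP x))).
Definition bs_idt (c : bs_ob) : bs_arr :=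
  SigSub (mem_set (bs_idtP (set_valP c))).
Definition bs_inv (x : bs_arr) : bs_arr :=
  SigSub (mem_set (bs_invP (set_valP x))).
(* Outside the composable pairs, where [(c, h + h')] may leave [bs_arr], the
   product is [x] by convention. *)
Definition bs_mul (x y : bs_arr) : bs_arr :=
  insubd x ((val x).1, (val x).2 + (val y).2).

Lemma val_bs_mul (x y : bs_arr) : bs_tgt x = bs_src y ->
  val (bs_mul x y) = ((val x).1, (val x).2 + (val y).2).
Proof.
move=> /(congr1 val) /= E; rewrite val_insubd mem_set //.
by apply: bs_mulP E; exact: set_valP.
Qed.

Lemma bs_laws : groupoid_laws bs_src bs_tgt bs_idt bs_inv bs_mul.
Proof.
split.
- by move=> c; apply: val_inj.
- by move=> c; apply: val_inj => /=; rewrite dress0.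
- by move=> x; apply: val_inj.
- by move=> x; apply: val_inj => /=; rewrite dressD subrr dress0.
- by move=> x y xy; apply: val_inj; rewrite /= val_bs_mul.
- move=> x y xy; apply: val_inj; rewrite /= val_bs_mul //= -dressD.
  by have /(congr1 val)/= -> := xy.
- move=> x y z xy yz; apply: val_inj.
  have xyz : bs_tgt x = bs_src (bs_mul y z).
    by apply: val_inj; rewrite /= val_bs_mul //; have /(congr1 val) := xy.
  have xyz' : bs_tgt (bs_mul x y) = bs_src z.
    rewrite -yz; apply: val_inj; rewrite /= val_bs_mul //= -dressD.
    by have /(congr1 val)/= -> := xy.
  by rewrite !val_bs_mul //= addrA.
- move=> x; apply: val_inj.
  rewrite val_bs_mul /= ?add0r -?surjective_pairing //.
  by apply: val_inj; rewrite /= dress0.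
- move=> x; apply: val_inj.
  rewrite val_bs_mul /= ?addr0 -?surjective_pairing //.
  exact: val_inj.
- move=> x; apply: val_inj; rewrite val_bs_mul /= ?subrr //.
  exact: val_inj.
- move=> x; apply: val_inj.
  rewrite val_bs_mul /= ?addNr //.
  by apply: val_inj; rewrite /= dressD subrr dress0.
Qed.

Definition bs_groupoid : groupoid := Groupoid bs_laws.

End BohrSommerfeld.

Section Sheu.
Variable n : nat.
Implicit Types (j : 'rV[int]_n) (k : 'rV[Zbar]_n).

Definition translate j k : 'rV[Zbar]_n := \row_i Zbar_add (j 0 i) (k 0 i).

Definition Nbar : set 'rV[Zbar]_n := [set k | forall i, Zbar_ge0 (k 0 i)].

Definition sheu_action : set ('rV[int]_n * 'rV[Zbar]_n) :=
  [set x | Nbar x.2 /\ Nbar (translate x.1 x.2)].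

Definition sheu_tilde : set ('rV[int]_n * 'rV[Zbar]_n) :=
  [set x | sheu_action x /\
    forall i, x.2 0 i = None ->
      \sum_(m < n | (m <= i)%N) x.1 0 m = 0 /\
      forall l : 'I_n, (i < l)%N -> x.1 0 l = 0].

Lemma translate0 k : translate 0 k = k.
Proof.
by apply/rowP => i; rewrite !mxE; case: (k 0 i) => //= m; rewrite add0r.
Qed.

Lemma translateD j j' k : translate j' (translate j k) = translate (j + j') k.
Proof.
apply/rowP => i; rewrite !mxE; case: (k 0 i) => //= m.
by rewrite addrA [j' 0 i + _]addrC.
Qed.

Lemma translate_None j k i : translate j k 0 i = None <-> k 0 i = None.
Proof. by rewrite mxE; case: (k 0 i). Qed.

Lemma tilde_srcP x : sheu_tilde x -> Nbar x.2.
Proof. by case=> -[]. Qed.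

Lemma tilde_tgtP x : sheu_tilde x -> Nbar (translate x.1 x.2).
Proof. by case=> -[]. Qed.

Lemma tilde_idtP k : Nbar k -> sheu_tilde (0, k).
Proof.
move=> k0; split=> [|i _]; first by split; rewrite //= translate0.
by split=> [|l _]; rewrite /= ?mxE // big1 // => l _; rewrite mxE.
Qed.

Lemma tilde_invP x : sheu_tilde x -> sheu_tilde (- x.1, translate x.1 x.2).
Proof.
case: x => j k [[/= k0 jk0] jP]; split.
  by split; rewrite //= translateD subrr translate0.
move=> i /translate_None /jP [s0 j0]; split=> [|l il] /=; last first.
  by rewrite mxE j0 ?oppr0.
by under eq_bigr do rewrite mxE; rewrite sumrN s0 oppr0.
Qed.

Lemma tilde_mulP x y : sheu_tilde x -> sheu_tilde y ->
  translate x.1 x.2 = y.2 -> sheu_tilde (x.1 + y.1, x.2).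
Proof.
case: x y => [j k] [j' k'] [/= [k0 jk0] jP] + /= E; rewrite -{k'}E.
move=> [[/= _ jk0'] jP']; split; first by split; rewrite //= -translateD.
move=> i ki; have [s0 j0] := jP i ki.
have [|s0' j0'] := jP' i; first by apply/translate_None.
split=> [|l il] /=; last by rewrite mxE j0 // j0' // addr0.
by under eq_bigr do rewrite mxE; rewrite big_split /= s0 s0' addr0.
Qed.

Definition tilde_src (x : sheu_tilde) : Nbar :=
  SigSub (mem_set (tilde_srcP (set_valP x))).
Definition tilde_tgt (x : sheu_tilde) : Nbar :=
  SigSub (mem_set (tilde_tgtP (set_valP x))).
Definition tilde_idt (k : Nbar) : sheu_tilde :=
  SigSub (mem_set (tilde_idtP (set_valP k))).
Definition tilde_inv (x : sheu_tilde) : sheu_tilde :=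
  SigSub (mem_set (tilde_invP (set_valP x))).
(* As for [bs_mul], a convention is used outside the composable pairs. *)
Definition tilde_mul (x y : sheu_tilde) : sheu_tilde :=
  insubd x ((val x).1 + (val y).1, (val x).2).

Lemma val_tilde_mul (x y : sheu_tilde) : tilde_tgt x = tilde_src y ->
  val (tilde_mul x y) = ((val x).1 + (val y).1, (val x).2).
Proof.
move=> /(congr1 val) /= E; rewrite val_insubd mem_set //.
by apply: tilde_mulP E; exact: set_valP.
Qed.

Lemma tilde_laws :
  groupoid_laws tilde_src tilde_tgt tilde_idt tilde_inv tilde_mul.
Proof.
split.
- by move=> k; apply: val_inj.
- by move=> k; apply: val_inj => /=; rewrite translate0.
- by move=> x; apply: val_inj.
- by move=> x; apply: val_inj => /=; rewrite translateD subrr translate0.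
- by move=> x y xy; apply: val_inj; rewrite /= val_tilde_mul.
- move=> x y xy; apply: val_inj; rewrite /= val_tilde_mul //= -translateD.
  by have /(congr1 val)/= -> := xy.
- move=> x y z xy yz; apply: val_inj.
  have xyz : tilde_tgt x = tilde_src (tilde_mul y z).
    by apply: val_inj; rewrite /= val_tilde_mul //; have /(congr1 val) := xy.
  have xyz' : tilde_tgt (tilde_mul x y) = tilde_src z.
    rewrite -yz; apply: val_inj; rewrite /= val_tilde_mul //= -translateD.
    by have /(congr1 val)/= -> := xy.
  by rewrite !val_tilde_mul //= addrA.
- move=> x; apply: val_inj.
  rewrite val_tilde_mul /= ?add0r -?surjective_pairing //.
  by apply: val_inj; rewrite /= translate0.
- move=> x; apply: val_inj.
  rewrite val_tilde_mul /= ?addr0 -?surjective_pairing //.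
  exact: val_inj.
- move=> x; apply: val_inj; rewrite val_tilde_mul /= ?subrr //.
  exact: val_inj.
- move=> x; apply: val_inj; rewrite val_tilde_mul /= ?addNr //.
  by apply: val_inj; rewrite /= translateD subrr translate0.
Qed.

(* (k_1, ..., k_(i-1), oo, ..., oo) *)
Definition trunc (i : 'I_n) k : 'rV[Zbar]_n :=
  \row_l if (i <= l)%N then None else k 0 l.

Definition arr_step (x y : sheu_tilde) : Prop :=
  exists i, (val x).2 0 i = None /\ val y = ((val x).1, trunc i (val x).2).

(* The restriction of [arr_step] to the units (0; k). *)
Definition ob_step (k k' : Nbar) : Prop :=
  exists i, val k 0 i = None /\ val k' = trunc i (val k).

Definition sheu_ob : topologicalType := generated_quotient ob_step.
Definition sheu_arr : topologicalType := generated_quotient arr_step.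

Definition sheu_src : sheu_arr -> sheu_ob := induced tilde_src.
Definition sheu_tgt : sheu_arr -> sheu_ob := induced tilde_tgt.
Definition sheu_idt : sheu_ob -> sheu_arr := induced tilde_idt.
Definition sheu_inv : sheu_arr -> sheu_arr := induced tilde_inv.

(* The choice of composable representatives is immaterial: see [sheu_mulE].
   They exist when the classes are composable: see [sheu_composable]. *)
Definition sheu_mul (a b : sheu_arr) : sheu_arr :=
  xget a [set c | exists x y : sheu_tilde,
    [/\ tilde_tgt x = tilde_src y, class x = a, class y = b &
        c = class (tilde_mul x y)]].

Lemma sheu_srcE x : sheu_src (class x) = class (tilde_src x).
Proof. by apply: induced_class => {}x y [i [? E]]; exists i; rewrite /= E. Qed.

Lemma sheu_tgtE x : sheu_tgt (class x) = class (tilde_tgt x).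
Proof.
apply: induced_class => {}x y [i [xi E]]; exists i; rewrite /= E.
split; first by apply/translate_None.
by apply/rowP => l; rewrite !mxE; case: ifP.
Qed.

Lemma sheu_idtE (k : Nbar) : sheu_idt (class k) = class (tilde_idt k).
Proof. by apply: induced_class => {}k l [i [? E]]; exists i; rewrite /= E. Qed.

Lemma sheu_invE x : sheu_inv (class x) = class (tilde_inv x).
Proof.
apply: induced_class => {}x y [i [xi E]]; exists i; rewrite /= E.
split; first by apply/translate_None.
by congr pair; apply/rowP => l; rewrite !mxE; case: ifP.
Qed.

(* The normal form of a vector: all entries from the first infinite one on
   become infinite. *)
Definition canon k : 'rV[Zbar]_n :=
  \row_l if [exists i : 'I_n, (i <= l)%N && (k 0 i == None)]
         then None else k 0 l.

Lemma canon_None k l :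
  canon k 0 l = None <-> exists2 i : 'I_n, (i <= l)%N & k 0 i = None.
Proof.
rewrite mxE; case: existsP => [[i /andP[il /eqP ki]]|nk]; first by split; eauto.
split=> [kl|[i il ki]]; first by exists l.
by case: nk; exists i; rewrite il ki eqxx.
Qed.

Lemma canon_Some k l m : canon k 0 l = Some m -> k 0 l = Some m.
Proof. by rewrite mxE; case: ifP. Qed.

Lemma canon_trunc i k : k 0 i = None -> canon (trunc i k) = canon k.
Proof.
move=> ki; apply/rowP => l; rewrite [LHS]mxE [RHS]mxE.
have -> : [exists t : 'I_n, (t <= l)%N && (trunc i k 0 t == None)] =
          [exists t : 'I_n, (t <= l)%N && (k 0 t == None)].
  apply/existsP/existsP => -[t /andP[tl]].
    rewrite mxE; case: ifP => [it _|_ /eqP kt]; last first.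
      by exists t; rewrite tl kt eqxx.
    by exists i; rewrite (leq_trans it tl) ki eqxx.
  by move=> /eqP kt; exists t; rewrite tl mxE kt; case: ifP.
case: existsP => // nk; rewrite mxE; case: ifP => // il.
by case: nk; exists i; rewrite il ki eqxx.
Qed.

Lemma canonE k : canon k = k \/ exists2 i, k 0 i = None & canon k = trunc i k.
Proof.
case: (pselect (exists i, k 0 i = None)) => [[i0 ki0]|nk]; last first.
  left; apply/rowP => l; rewrite mxE; case: existsP => // -[i /andP[_ /eqP ki]].
  by case: nk; exists i.
have := @arg_minnP _ i0 [pred i | k 0 i == None] (fun i : 'I_n => i : nat).
rewrite /= ki0 eqxx => /(_ isT) [i /eqP ki imin].
right; exists i => //; apply/rowP => l; rewrite !mxE.
case: existsP => [[t /andP[tl /imin it]]|nkl].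
  by rewrite (leq_trans it tl).
by case: ifP => // il; case: nkl; exists i; rewrite il ki eqxx.
Qed.

Lemma canonK k : canon (canon k) = canon k.
Proof.
have [E|[i ki E]] := canonE k; first by rewrite !E.
by rewrite {1}E canon_trunc.
Qed.

Lemma sum_after j (i l : 'I_n) : (i <= l)%N ->
  \sum_(m < n | (m <= i)%N) j 0 m = 0 ->
  (forall t : 'I_n, (i < t)%N -> j 0 t = 0) ->
  \sum_(m < n | (m <= l)%N) j 0 m = 0.
Proof.
move=> il s0 j0; rewrite (bigID (fun m : 'I_n => (m <= i)%N)) /=.
rewrite [X in _ + X]big1 ?addr0; last first.
  by move=> m /andP[_]; rewrite -ltnNge => /j0.
rewrite -[RHS]s0; apply: eq_bigl => m.
by case: (leqP m i) => [mi|]; rewrite ?andbF // (leq_trans mi il).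
Qed.

Lemma tilde_canon j k k' : sheu_tilde (j, k) -> Nbar k' ->
  canon k = canon k' -> sheu_tilde (j, k').
Proof.
move=> [[/= k0 jk0] jP] k'0 E.
have jP' i : k' 0 i = None -> \sum_(m < n | (m <= i)%N) j 0 m = 0 /\
    forall l : 'I_n, (i < l)%N -> j 0 l = 0.
  move=> ki; have : canon k 0 i = None by rewrite E; apply/canon_None; exists i.
  move=> /canon_None [i' i'i ki']; have [s0 j0] := jP _ ki'.
  split=> [|l il]; first exact: (sum_after i'i s0 j0).
  exact/j0/(leq_ltn_trans i'i).
split=> //; split=> //= l; rewrite mxE; case k'l: (k' 0 l) => [m|//].
case cl: (canon k 0 l) => [m'|].
  have /canon_Some := cl; move: cl; rewrite E => /canon_Some.
  by rewrite k'l => -[<-] kl; have := jk0 l; rewrite mxE kl.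
move: cl; rewrite E => /canon_None [i il ki].
have [_ ->] := jP' i ki; first by have := k'0 l; rewrite k'l /= add0r.
rewrite ltn_neqAle il andbT; apply: contraPneq k'l => /ord_inj <-.
by rewrite ki.
Qed.

Lemma class_arrP (x y : sheu_tilde) : class x = class y :> sheu_arr <->
  (val x).1 = (val y).1 /\ canon (val x).2 = canon (val y).2.
Proof.
split=> [/classP|[E1 E2]].
  elim=> [u v [i [ui ->]]|//|u v _ [-> ->] //|].
    by rewrite canon_trunc.
  by move=> u v w _ [-> ->] _ [-> ->].
suff canonic (w : sheu_tilde) : exists2 z : sheu_tilde,
    class w = class z :> sheu_arr & val z = ((val w).1, canon (val w).2).
  have [x' -> Ex'] := canonic x; have [y' -> Ey'] := canonic y.
  by congr class; apply: val_inj; rewrite Ex' Ey' E1 E2.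
have zP : sheu_tilde ((val w).1, canon (val w).2).
  apply: (@tilde_canon _ (val w).2); last by rewrite canonK.
    by rewrite -surjective_pairing; exact: set_valP.
  move=> l; rewrite mxE; case: ifP => // _.
  exact: (tilde_srcP (set_valP w)).
exists (SigSub (mem_set zP)) => //; apply/classP.
have [E|[i wi E]] := canonE (val w).2.
  suff <- : w = SigSub (mem_set zP) by exact: rst_refl.
  by apply: val_inj; rewrite /= E -surjective_pairing.
by apply: rst_step; exists i; rewrite /= E.
Qed.

Lemma class_obP (k l : Nbar) : class k = class l :> sheu_ob <->
  canon (val k) = canon (val l).
Proof.
split=> [/classP|E].
  elim=> [u v [i [ui ->]]|//|u v _ -> //|u v w _ -> _ -> //].
  by rewrite canon_trunc.
suff canonic (w : Nbar) : exists2 z : Nbar,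
    class w = class z :> sheu_ob & val z = canon (val w).
  have [k' -> Ek] := canonic k; have [l' -> El] := canonic l.
  by congr class; apply: val_inj; rewrite Ek El E.
have zP : Nbar (canon (val w)).
  by move=> i; rewrite mxE; case: ifP => // _; exact: (set_valP w).
exists (SigSub (mem_set zP)) => //; apply/classP.
have [F|[i wi F]] := canonE (val w).
  suff <- : w = SigSub (mem_set zP) by exact: rst_refl.
  by apply: val_inj; rewrite /= F.
by apply: rst_step; exists i; rewrite /= F.
Qed.

Lemma sheu_mulE x y : tilde_tgt x = tilde_src y ->
  sheu_mul (class x) (class y) = class (tilde_mul x y).
Proof.
move=> xy; rewrite /sheu_mul; case: xgetP => [c _|/(_ (class (tilde_mul x y)))].
  move=> [x' [y' [xy' /class_arrP[X1 X2] /class_arrP[Y1 Y2] ->]]].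
  by apply/class_arrP; rewrite !val_tilde_mul //= X1 X2 Y1.
by case; exists x, y.
Qed.

Lemma sheu_composable (a b : sheu_arr) : sheu_tgt a = sheu_src b ->
  forall x, a = class x -> exists2 y, b = class y & tilde_tgt x = tilde_src y.
Proof.
move=> ab x aE; move: ab; rewrite aE -[b]repK; move: (rep b) => y.
rewrite sheu_tgtE sheu_srcE => /class_obP /= E.
have zP : sheu_tilde ((val y).1, translate (val x).1 (val x).2).
  apply: (@tilde_canon _ (val y).2) => //.
    by rewrite -surjective_pairing; exact: set_valP.
  exact: tilde_tgtP (set_valP x).
exists (SigSub (mem_set zP)); last exact: val_inj.
by apply/class_arrP.
Qed.

Lemma sheu_laws :
  groupoid_laws sheu_src sheu_tgt sheu_idt sheu_inv sheu_mul.
Proof.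
split.
- by move=> a; rewrite -[a]repK sheu_idtE sheu_srcE (src_idt tilde_laws).
- by move=> a; rewrite -[a]repK sheu_idtE sheu_tgtE (tgt_idt tilde_laws).
- move=> a; rewrite -[a]repK sheu_invE sheu_srcE sheu_tgtE.
  by rewrite (src_inv tilde_laws).
- move=> a; rewrite -[a]repK sheu_invE sheu_srcE sheu_tgtE.
  by rewrite (tgt_inv tilde_laws).
- move=> a b ab; have [y -> xy] := sheu_composable ab (esym (repK a)).
  by rewrite -[a]repK sheu_mulE // !sheu_srcE (src_mul tilde_laws).
- move=> a b ab; have [y -> xy] := sheu_composable ab (esym (repK a)).
  by rewrite -[a]repK sheu_mulE // !sheu_tgtE (tgt_mul tilde_laws).
- move=> a b c ab bc; have [y yE xy] := sheu_composable ab (esym (repK a)).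
  have [z -> yz] := sheu_composable bc yE; rewrite yE -[a]repK.
  rewrite !sheu_mulE // ?(mul_assoc tilde_laws) //.
    by rewrite (tgt_mul tilde_laws).
  by rewrite (src_mul tilde_laws).
- by move=> a; rewrite -[a]repK sheu_srcE sheu_idtE sheu_mulE
    ?(mul_idl tilde_laws) ?(tgt_idt tilde_laws).
- by move=> a; rewrite -[a]repK sheu_tgtE sheu_idtE sheu_mulE
    ?(mul_idr tilde_laws) ?(src_idt tilde_laws).
- move=> a; rewrite -[a]repK sheu_invE sheu_srcE sheu_idtE.
  by rewrite sheu_mulE ?(mul_invr tilde_laws) ?(src_inv tilde_laws).
- move=> a; rewrite -[a]repK sheu_invE sheu_tgtE sheu_idtE.
  by rewrite sheu_mulE ?(mul_invl tilde_laws) ?(tgt_inv tilde_laws).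
Qed.

Definition sheu_groupoid : groupoid := Groupoid sheu_laws.

End Sheu.

Section Phi.
Variables (R : realType) (n : nat) (hbar : R).

(* The q with c = 1 - e^(- hbar q), and the p with h = hbar p. *)
Definition q_of (c : R) : Zbar := xget None [set q | c = 1 - expNZ hbar q].
Definition p_of (h : R) : int := xget 0 [set p | h = hbar * p%:~R].

(* (p_1, p_2 - p_1, ..., p_n - p_(n-1)) *)
Definition pdiff (p : 'rV[int]_n) : 'rV[int]_n :=
  \row_i if i == 0%N :> nat then p 0 i else p 0 i - p 0 (ord_pred i).

(* (q_1, q_2 - q_1, ..., q_n - q_(n-1)) *)
Definition qdiff (q : 'rV[Zbar]_n) : 'rV[Zbar]_n :=
  \row_i if i == 0%N :> nat then q 0 i else Zbar_sub (q 0 i) (q 0 (ord_pred i)).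

Definition Phi_rep (x : 'rV[R]_n * 'rV[R]_n) : 'rV[int]_n * 'rV[Zbar]_n :=
  (pdiff (\row_i p_of (x.2 0 i)), qdiff (\row_i q_of (x.1 0 i))).

Lemma val_ord_pred (i : 'I_n) : i != 0%N :> nat -> (ord_pred i).+1 = i :> nat.
Proof.
case: i => -[|i] //= ltin _.
by rewrite modnDr modn_small // ltnW.
Qed.

Lemma sum_pdiff (p : 'rV[int]_n) (i : 'I_n) :
  \sum_(m < n | (m <= i)%N) pdiff p 0 m = p 0 i.
Proof.
case: i => i; elim: i => [|i IH] ltin.
  rewrite (bigD1 (Ordinal ltin)) //= big1 ?addr0 ?mxE //= => m.
  by rewrite leqn0 => /andP[/eqP m0 /negP[]]; apply/eqP/val_inj.
have ltin' := ltnW ltin.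
rewrite (bigD1 (Ordinal ltin)) //=.
rewrite (eq_bigl (fun m : 'I_n => (m <= Ordinal ltin')%N)); last first.
  by move=> m; rewrite -val_eqE /= andbC -ltn_neqAle.
rewrite IH mxE /=; suff -> : ord_pred (Ordinal ltin) = Ordinal ltin'.
  by rewrite subrK.
by apply: ord_inj; have := @val_ord_pred (Ordinal ltin) isT => /= -[].
Qed.

Hypothesis hbar_gt0 : 0 < hbar.

Lemma p_ofE h : in_hbarZ hbar h -> h = hbar * (p_of h)%:~R.
Proof.
rewrite /p_of; case: xgetP => [p _ //|nP [m hm]].
by case: (nP m).
Qed.

Lemma p_of0 : p_of 0 = 0.
Proof.
have /eqP := p_ofE (in_hbarZ0 hbar); rewrite eq_sym mulf_eq0 gt_eqF //=.
by rewrite intr_eq0 => /eqP.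
Qed.

Lemma q_ofE c : c <= 1 -> (c <> 1 -> in_hbarZ hbar (ln (1 - c))) ->
  c = 1 - expNZ hbar (q_of c).
Proof.
move=> c1 cZ; rewrite /q_of; case: xgetP => [q _ //|nP].
have [E|ne1] := pselect (c = 1).
  by case: (nP None); rewrite /= subr0.
have [m hm] := cZ ne1; case: (nP (Some (- m))) => /=.
rewrite mulrNz mulrN opprK -hm lnK ?posrE ?subr_gt0; first by rewrite subKr.
by rewrite lt_neqAle c1 andbT; apply/eqP.
Qed.

Lemma expNZ_None q : expNZ hbar q = 0 <-> q = None.
Proof.
case: q => [m|]; split=> //= /eqP; by rewrite gt_eqF ?expR_gt0.
Qed.

Lemma expNZ_le (a b : int) :
  (expNZ hbar (Some a) <= expNZ hbar (Some b)) = (b <= a).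
Proof. by rewrite /= ler_expR lerN2 ler_pM2l // ler_int. Qed.

Lemma qdiff_ge0 (c : 'rV[R]_n) (q : 'rV[Zbar]_n) :
  Delta c -> (forall i, c 0 i = 1 - expNZ hbar (q 0 i)) -> Nbar (qdiff q).
Proof.
move=> [D01 Dm] cq i; rewrite mxE; case: ifPn => [_|i0].
  have /andP[+ _] := D01 i; rewrite cq subr_ge0; case: (q 0 i) => // a.
  by rewrite -(expR0 R) /= ler_expR oppr_le0 pmulr_rge0 // ler0z.
have /Dm : (ord_pred i <= i)%N by rewrite -[leqRHS](val_ord_pred i0).
rewrite !cq lerD2l lerN2.
case: (q 0 i) => [a|] //; case: (q 0 _) => [b|] //.
by rewrite expNZ_le /= subr_ge0.
Qed.

Lemma translate_diff (p : 'rV[int]_n) (q : 'rV[Zbar]_n) :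
  translate (pdiff p) (qdiff q) = qdiff (translate p q).
Proof.
apply/rowP => i; rewrite !mxE; case: ifP => // _.
case: (q 0 i) => [a|] //; case: (q 0 _) => [b|] //=; congr Some; ring.
Qed.

Lemma dress_expNZ (c h : 'rV[R]_n) (p : int) (q : Zbar) i :
  c 0 i = 1 - expNZ hbar q -> h 0 i = hbar * p%:~R ->
  dress c h 0 i = 1 - expNZ hbar (Zbar_add p q).
Proof.
move=> ci hi; rewrite mxE ci hi; case: q {ci} => [m|] /=; last by ring.
by rewrite intrD [hbar * (_ + _)]mulrDr opprD expRD; ring.
Qed.

Lemma Phi_repP x : bs_arr hbar x -> sheu_tilde (Phi_rep x).
Proof.
case: x => c h [/= Dc Dr hZ cZ h0]; rewrite /Phi_rep /=.
set p := \row_i p_of _; set q := \row_i q_of _.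
have pE i : h 0 i = hbar * (p 0 i)%:~R by rewrite mxE -p_ofE.
have qE i : c 0 i = 1 - expNZ hbar (q 0 i).
  rewrite mxE; apply: q_ofE (cZ i).
  by have [/(_ i)/andP[]] := Dc.
have c1 i : q 0 i = None -> c 0 i = 1 by rewrite qE => ->; rewrite subr0.
have c1_after (i l : 'I_n) : (i <= l)%N -> c 0 i = 1 -> c 0 l = 1.
  move=> il ci; have [/(_ l)/andP[_ cl1] /(_ i l il)] := Dc.
  by rewrite ci => cl; apply/le_anti; rewrite cl1.
have p0 i : c 0 i = 1 -> p 0 i = 0 by move=> /h0 hi; rewrite mxE hi p_of0.
split; first split => /=.
- exact: qdiff_ge0 Dc qE.
- rewrite translate_diff; apply: qdiff_ge0 Dr _ => i.
  by rewrite (dress_expNZ (qE i) (pE i)) [translate _ _ _ _]mxE.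
move=> i /= qi; have {qi} ci : c 0 i = 1.
  move: qi; rewrite mxE; case: ifPn => [_|i0]; first exact: c1.
  have predi : (ord_pred i <= i)%N by rewrite -[leqRHS](val_ord_pred i0).
  case Ei: (q 0 i) => [a|]; last by rewrite c1.
  case El: (q 0 (ord_pred i)) => [b|] // _.
  exact: c1_after predi (c1 _ El).
split=> [|l il]; first by rewrite sum_pdiff p0.
have l0 : l != 0%N :> nat by rewrite -lt0n (leq_ltn_trans _ il).
have ipred : (i <= ord_pred l)%N by rewrite -ltnS val_ord_pred.
rewrite mxE (negbTE l0) !p0 ?subrr //; first exact: c1_after ipred ci.
exact: c1_after (ltnW il) ci.
Qed.

Definition Phi (x : arr (bs_groupoid n hbar)) : arr (sheu_groupoid n) :=
  class (SigSub (mem_set (Phi_repP (set_valP x))) : @sheu_tilde n) : sheu_arr n.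

Lemma expNZ_inj : injective (expNZ hbar).
Proof.
move=> [a|] [b|] //= E; last 2 first.
- by have := expR_gt0 (- (hbar * a%:~R)); rewrite E ltxx.
- by have := expR_gt0 (- (hbar * b%:~R)); rewrite -E ltxx.
by congr Some; apply/le_anti; rewrite -!expNZ_le /= E lexx.
Qed.

Lemma canon_eq (k l : 'rV[Zbar]_n) :
  (forall i, k 0 i = l 0 i \/
     exists t : 'I_n, [/\ (t < i)%N, k 0 t = None & l 0 t = None]) ->
  canon k = canon l.
Proof.
move=> kl; apply/rowP => i; rewrite [LHS]mxE [RHS]mxE.
have -> : [exists t : 'I_n, (t <= i)%N && (k 0 t == None)] =
          [exists t : 'I_n, (t <= i)%N && (l 0 t == None)].
  apply/existsP/existsP => -[t /andP[ti /eqP Et]].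
    have [E|[u [ut _ lu]]] := kl t; first by exists t; rewrite ti -E Et eqxx.
    by exists u; rewrite (leq_trans (ltnW ut) ti) lu eqxx.
  have [E|[u [ut ku _]]] := kl t; first by exists t; rewrite ti E Et eqxx.
  by exists u; rewrite (leq_trans (ltnW ut) ti) ku eqxx.
case: existsP => // nl; have [//|[t [ti _ lt]]] := kl i.
by case: nl; exists t; rewrite (ltnW ti) lt eqxx.
Qed.

(* The values given to the differences oo - oo do not matter. *)
Lemma PhiE (x : arr (bs_groupoid n hbar)) (p : 'rV[int]_n) (q : 'rV[Zbar]_n)
    (y : @sheu_tilde n) :
  (forall i, (val x).1 0 i = 1 - expNZ hbar (q 0 i)) ->
  (forall i, (val x).2 0 i = hbar * (p 0 i)%:~R) ->
  (val y).1 = pdiff p ->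
  (forall i : 'I_n, (i = 0%N :> nat \/ q 0 (ord_pred i) <> None) ->
     (val y).2 0 i = qdiff q 0 i) ->
  Phi x = class y.
Proof.
move=> xq xp yp yq; have [/= [D01 _] _ hZ cZ _] := set_valP x.
have qE : \row_i q_of ((val x).1 0 i) = q.
  apply/rowP => i; rewrite mxE; apply: expNZ_inj.
  apply/oppr_inj/(addrI 1); rewrite -xq; apply/esym/q_ofE; last exact: cZ.
  by have /andP[] := D01 i.
have pE : \row_i p_of ((val x).2 0 i) = p.
  apply/rowP => i; rewrite mxE; apply/eqP; rewrite -(@eqr_int R); apply/eqP.
  by apply: (mulfI (lt0r_neq0 hbar_gt0)); rewrite -xp -p_ofE.
apply/class_arrP; rewrite /= /Phi_rep /= qE pE yp; split=> //.
apply: canon_eq => i; have [i0|/eqP i0] := pselect (i = 0%N :> nat).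
  by left; rewrite yq //; left.
have [qi|qi] := pselect (q 0 (ord_pred i) = None); last first.
  by left; rewrite yq //; right.
right; have := @arg_minnP _ (ord_pred i) [pred t | q 0 t == None]
  (fun t : 'I_n => t : nat).
rewrite /= qi eqxx => /(_ isT) [t /eqP qt tmin].
have t0 : t = 0%N :> nat \/ q 0 (ord_pred t) <> None.
  have [->|t0] := eqVneq (t : nat) 0%N; [by left|right => /eqP/tmin].
  by rewrite -[X in (X <= _)%N](val_ord_pred t0) ltnn.
exists t; rewrite yq // mxE qt; split; [|by case: ifP..].
by rewrite -[ltnRHS](val_ord_pred i0) ltnS tmin //; apply/eqP.
Qed.

End Phi.

(* Main.v *)
Require Import Defs.
From HB Require Import structures.
From mathcomp Require Import all_boot all_order all_algebra.
From mathcomp Require Import all_classical all_reals all_analysis.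
From mathcomp Require Import ring lra.
Import Order.TTheory GRing.Theory Num.Theory.
Import numFieldNormedType.Exports.

Set Implicit Arguments.
Unset Strict Implicit.
Unset Printing Implicit Defensive.

Local Open Scope classical_set_scope.
Local Open Scope ring_scope.

(** Partial sums turn the coordinates (j; k) of Sheu's groupoid into (p, q), so
    the inverse of Phi is induced by
      (j; k) |-> (1 - prod_(m <= i) e^(- hbar k_m), hbar sum_(m <= i) j_m)_i,
    which is continuous because every factor e^(- hbar k) is continuous in k up
    to k = oo; it identifies exactly the equivalent arrows, since the products
    vanish from the first infinite k_m on.

    Phi itself has no continuous lift to the arrows (j; k): a difference
    q_i - q_(i-1) has no limit when both entries tend to oo. Its continuity
    comes from compactness of \bar N^n: h is locally constant, and every
    cluster point k of the lifts along c -> c_0 satisfies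
    1 - prod_(m <= i) e^(- hbar k_m) = (c_0)_i, so it represents Phi(c_0, h). *)

(** * Sums and products over initial segments of indices *)

Section Prefix.
Variables (T : Type) (idx : T) (op : Monoid.com_law idx) (n : nat).
Implicit Types (F : 'I_n -> T) (i : 'I_n).

Lemma big_prefix0 F i : i = 0%N :> nat ->
  \big[op/idx]_(m < n | (m <= i)%N) F m = F i.
Proof.
move=> i0; rewrite (big_pred1 i) // => m.
by rewrite i0 leqn0 /= -val_eqE /= i0.
Qed.

Lemma big_prefixS F i : i != 0%N :> nat ->
  \big[op/idx]_(m < n | (m <= i)%N) F m =
  op (\big[op/idx]_(m < n | (m <= ord_pred i)%N) F m) (F i).
Proof.
move=> i0; rewrite (bigD1 i) //= Monoid.mulmC; congr (op _ _).
apply: eq_bigl => m; rewrite andbC -val_eqE /= -ltn_neqAle.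
by rewrite -[X in (_ < X)%N](val_ord_pred i0).
Qed.

End Prefix.

Lemma pdiff_psum n (j : 'rV[int]_n) :
  pdiff (\row_i \sum_(m < n | (m <= i)%N) j 0 m) = j.
Proof.
apply/rowP => i; rewrite !mxE; case: ifPn => [/eqP i0|i0].
  by rewrite big_prefix0.
by rewrite (big_prefixS _ _ i0) /= addrAC subrr add0r.
Qed.

(** * The exponentials of partial sums as an invariant of classes *)

Section PrefixExp.
Variables (R : realType) (n : nat) (hbar : R).
Implicit Types (k : 'rV[Zbar]_n) (i : 'I_n).

(* e^(- hbar (k_1 + ... + k_i)) *)
Definition prefix_exp k i : R :=
  \prod_(m < n | (m <= i)%N) expNZ hbar (k 0 m).

Lemma expNZ_ge0 q : 0 <= expNZ hbar q.
Proof. by case: q => //= m; exact: expR_ge0. Qed.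

Lemma expNZ_add j q : expNZ hbar (Zbar_add j q) =
  expR (- (hbar * j%:~R)) * expNZ hbar q.
Proof.
by case: q => [m|] /=; rewrite ?mulr0 // intrD mulrDr opprD expRD.
Qed.

Lemma prefix_exp0 k i : i = 0%N :> nat -> prefix_exp k i = expNZ hbar (k 0 i).
Proof. exact: big_prefix0. Qed.

Lemma prefix_expS k i : i != 0%N :> nat ->
  prefix_exp k i = prefix_exp k (ord_pred i) * expNZ hbar (k 0 i).
Proof. exact: big_prefixS. Qed.

Lemma prefix_exp_ge0 k i : 0 <= prefix_exp k i.
Proof. by apply: prodr_ge0 => m _; exact: expNZ_ge0. Qed.

Lemma prefix_exp_eq0 k i :
  prefix_exp k i = 0 <-> exists2 m : 'I_n, (m <= i)%N & k 0 m = None.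
Proof.
split=> [/eqP/prodf_eq0[m mi /eqP/expNZ_None km]|[m mi km]]; first by exists m.
by apply/eqP/prodf_eq0; exists m; rewrite // km.
Qed.

(** This yields the Bohr-Sommerfeld condition on log(1 - c_i) for [Psi_rep]. The exponent q is the
    sum k_1 + ... + k_i in [Zbar], built one term at a time. *)
Lemma prefix_exp_expNZ k i : exists q, prefix_exp k i = expNZ hbar q.
Proof.
rewrite /prefix_exp.
apply: (big_ind (fun x => exists q, x = expNZ hbar q)) => [|x y|m _].
- by exists (Some 0); rewrite /= mulr0 oppr0 expR0.
- move=> [[a|] ->] [q ->]; last by exists None; rewrite mul0r.
  by exists (Zbar_add a q); rewrite expNZ_add.
- by exists (k 0 m).
Qed.

(** Each factor picks up e^(- hbar j_m), also at infinity, where both sides vanish. Hence k + j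
    corresponds to the target r(c, h). *)
Lemma prefix_exp_translate (j : 'rV[int]_n) k i :
  prefix_exp (translate j k) i =
  expR (- (hbar * (\sum_(m < n | (m <= i)%N) j 0 m)%:~R)) * prefix_exp k i.
Proof.
rewrite /prefix_exp (eq_bigr (fun m => expR (- (hbar * (j 0 m)%:~R)) *
  expNZ hbar (k 0 m))) => [|m _]; last by rewrite mxE expNZ_add.
rewrite big_split /=; congr (_ * _).
by rewrite rmorph_sum mulr_sumr -sumrN expR_sum.
Qed.

Hypothesis hbar_gt0 : 0 < hbar.

Lemma expNZ_le1 q : Zbar_ge0 q -> expNZ hbar q <= 1.
Proof.
case: q => [m|_] /=; last exact: ler01.
by move=> m0; rewrite -[leRHS](expR0 R) ler_expR oppr_le0 pmulr_rge0 // ler0z.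
Qed.

Lemma prod_expNZ_le1 k (P : pred 'I_n) : Nbar k ->
  \prod_(m < n | P m) expNZ hbar (k 0 m) <= 1.
Proof.
move=> k0.
(* The lower bound 0 is carried along because a product of factors at most 1 stays at most 1 only if
   they are nonnegative. *)
suff /andP[] : 0 <= \prod_(m < n | P m) expNZ hbar (k 0 m) <= 1 by [].
apply: (big_ind (fun x => 0 <= x <= 1)) => [|x y|m _].
- by rewrite ler01 lexx.
- by move=> /andP[? ?] /andP[? ?]; rewrite mulr_ge0 //= mulr_ile1.
- by rewrite expNZ_ge0 expNZ_le1.
Qed.

Lemma prefix_exp_homo k (i l : 'I_n) : Nbar k -> (i <= l)%N ->
  prefix_exp k l <= prefix_exp k i.
Proof.
move=> k0 il; rewrite {1}/prefix_exp (bigID (fun m : 'I_n => (m <= i)%N)) /=.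
rewrite [X in X * _](_ : _ = prefix_exp k i); last first.
  apply: eq_bigl => m.
  by case: (leqP m i) => [mi|]; rewrite ?andbF // (leq_trans mi il).
apply: ler_piMr; first exact: prefix_exp_ge0.
exact: prod_expNZ_le1.
Qed.

(** The factors lie in [0, 1], so the partial products lie there too and decrease with i. *)
Lemma Delta_prefix_exp k : Nbar k -> Delta (\row_i (1 - prefix_exp k i)).
Proof.
move=> k0; split=> [i|i l il]; rewrite !mxE; last first.
  by rewrite lerD2l lerN2 prefix_exp_homo.
rewrite subr_ge0 gerBl prefix_exp_ge0 andbT.
exact: prod_expNZ_le1.
Qed.

(** The partial products are a complete invariant of the class of k. The first one that vanishes
    marks the first infinite entry; before it, dividing by the preceding nonzero product recovers
    k_i. *)
Lemma canon_eq_prefix_exp k k' :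
  Defs.canon k = Defs.canon k' <-> forall i, prefix_exp k i = prefix_exp k' i.
Proof.
have noneE (l : 'rV[Zbar]_n) i : Defs.canon l 0 i = None <-> prefix_exp l i = 0.
  by split=> [/canon_None/prefix_exp_eq0|/prefix_exp_eq0/canon_None].
have someE (l : 'rV[Zbar]_n) i : Defs.canon l 0 i <> None ->
    Defs.canon l 0 i = l 0 i.
  by case E: (Defs.canon l 0 i) => [a|] // _; rewrite (canon_Some E).
split=> [E i|E].
  have [ci|ci] := pselect (Defs.canon k 0 i = None).
    by rewrite (noneE k i).1 // (noneE k' i).1 // -E.
  apply: eq_bigr => m mi; have cm : Defs.canon k 0 m <> None.
    move=> /canon_None[t tm kt]; apply/ci/canon_None.
    by exists t; rewrite // (leq_trans tm).
  by rewrite -(someE k) // E someE // -E.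
apply/rowP => i; have [ci|ci] := pselect (Defs.canon k 0 i = None).
  by rewrite ci; apply/esym/noneE; rewrite -E; apply/noneE.
have ci' : Defs.canon k' 0 i <> None by move=> /noneE; rewrite -E => /noneE.
rewrite (someE k) // (someE k') //; apply: (expNZ_inj hbar_gt0).
have := E i; have [i0|i0] := eqVneq (i : nat) 0%N.
  by rewrite !prefix_exp0.
rewrite (prefix_expS k i0) (prefix_expS k' i0) -E; apply: mulfI.
apply/eqP => /prefix_exp_eq0[t ti kt]; apply: ci; apply/canon_None.
by exists t => //; rewrite (leq_trans ti) // -[leqRHS](val_ord_pred i0).
Qed.

(** The product telescopes as long as q is finite. By hypothesis the infinite entries of q form a
    final segment, on which both sides are 0. *)
Lemma prefix_exp_qdiff (q : 'rV[Zbar]_n) :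
  (forall i : 'I_n, i != 0%N :> nat ->
     q 0 (ord_pred i) = None -> q 0 i = None) ->
  forall i, prefix_exp (qdiff q) i = expNZ hbar (q 0 i).
Proof.
move=> qN [i]; elim: i => [|i IH] ltin.
  by rewrite prefix_exp0 // mxE.
rewrite prefix_expS //.
have -> : ord_pred (Ordinal ltin) = Ordinal (ltnW ltin).
  by apply: ord_inj; have := @val_ord_pred _ (Ordinal ltin) isT => /= -[].
rewrite IH mxE /=; have := qN (Ordinal ltin) isT.
have -> : ord_pred (Ordinal ltin) = Ordinal (ltnW ltin).
  by apply: ord_inj; have := @val_ord_pred _ (Ordinal ltin) isT => /= -[].
case: (q 0 (Ordinal (ltnW ltin))) => [b _|-> //]; last by rewrite mul0r.
case: (q 0 _) => [a|] /=; last by rewrite mulr0.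
by rewrite -expRD intrB; congr expR; ring.
Qed.

End PrefixExp.

(** * The inverse of [Phi] and compatibility with the groupoid structure *)

Section Inverse.
Variables (R : realType) (n : nat) (hbar : R).
Hypothesis hbar_gt0 : 0 < hbar.
Implicit Types (x : 'rV[R]_n * 'rV[R]_n) (y : 'rV[int]_n * 'rV[Zbar]_n).

Lemma p_ofK (p : int) : p_of hbar (hbar * p%:~R) = p.
Proof.
apply/eqP; rewrite -(@eqr_int R); apply/eqP.
apply: (mulfI (lt0r_neq0 hbar_gt0)); rewrite -p_ofE //.
by exists p.
Qed.

Lemma q_ofK q : q_of hbar (1 - expNZ hbar q) = q.
Proof.
rewrite /q_of; case: xgetP => [q' _ /= /addrI/oppr_inj|].
  by move=> /(expNZ_inj hbar_gt0).
by move=> /(_ q) [].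
Qed.

Lemma bs_arr_q x i : bs_arr hbar x ->
  x.1 0 i = 1 - expNZ hbar (q_of hbar (x.1 0 i)).
Proof.
case=> [[D01 _] _ _ cZ _]; apply: q_ofE (cZ i).
by have /andP[] := D01 i.
Qed.

Lemma bs_arr_p x i : bs_arr hbar x ->
  x.2 0 i = hbar * (p_of hbar (x.2 0 i))%:~R.
Proof. by case=> _ _ hZ _ _; exact: p_ofE. Qed.

Lemma prefix_exp_Phi_rep x i : bs_arr hbar x ->
  prefix_exp hbar (Phi_rep hbar x).2 i = 1 - x.1 0 i.
Proof.
move=> Ax; rewrite prefix_exp_qdiff => [|l l0].
  by rewrite mxE [in RHS](bs_arr_q _ Ax) subKr.
(* The hypothesis of [prefix_exp_qdiff]: c is nondecreasing and bounded by 1, so once it reaches 1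
   it stays there, and q stays infinite. *)
rewrite !mxE => qN; have [[D01 Dm] _ _ _ _] := Ax.
have c1 : x.1 0 (ord_pred l) = 1 by rewrite (bs_arr_q _ Ax) qN /= subr0.
have : x.1 0 (ord_pred l) <= x.1 0 l.
  by apply: Dm; rewrite -[leqRHS](val_ord_pred l0).
rewrite c1 => cl; have -> : x.1 0 l = 1 - expNZ hbar None.
  by apply/le_anti; rewrite /= subr0 cl; have /andP[_ ->] := D01 l.
exact: q_ofK.
Qed.

Definition Psi_rep y : 'rV[R]_n * 'rV[R]_n :=
  (\row_i (1 - prefix_exp hbar y.2 i),
   \row_i (hbar * (\sum_(m < n | (m <= i)%N) y.1 0 m)%:~R)).

Lemma dress_Psi_rep y : dress (Psi_rep y).1 (Psi_rep y).2 =
  \row_i (1 - prefix_exp hbar (translate y.1 y.2) i).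
Proof.
by apply/rowP => i; rewrite !mxE prefix_exp_translate; ring.
Qed.

Lemma Psi_repP y : sheu_tilde y -> bs_arr hbar (Psi_rep y).
Proof.
move=> [[k0 jk0] yP]; split.
- exact: Delta_prefix_exp.
- by rewrite dress_Psi_rep; exact: Delta_prefix_exp.
- by move=> i; rewrite mxE; eexists.
- move=> i; rewrite mxE subKr; have [[m|] ->] := prefix_exp_expNZ hbar y.2 i.
    by move=> _; exists (- m); rewrite /= expRK mulrNz mulrN.
  by rewrite /= subr0.
- move=> i; rewrite !mxE => c1.
  (* If c_i = 1, some k_m with m <= i is infinite. The condition defining [sheu_tilde] makes the sum
     of j up to m vanish, and j is 0 after m, so h_i = 0. *)
  have /prefix_exp_eq0[m mi /yP[s0 j0]] : prefix_exp hbar y.2 i = 0 by lra.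
  by rewrite (sum_after mi s0 j0) mulr0.
Qed.

Lemma Phi_repK x : bs_arr hbar x -> Psi_rep (Phi_rep hbar x) = x.
Proof.
move=> Ax; rewrite [RHS]surjective_pairing; congr pair; apply/rowP => i.
  by rewrite mxE prefix_exp_Phi_rep // subKr.
by rewrite mxE sum_pdiff mxE -bs_arr_p.
Qed.

Lemma Phi_rep_Psi_rep1 y : (Phi_rep hbar (Psi_rep y)).1 = y.1.
Proof.
rewrite /= -[RHS]pdiff_psum; congr pdiff.
by apply/rowP => i; rewrite !mxE p_ofK.
Qed.

Lemma Psi_rep_canon y y' : y.1 = y'.1 -> Defs.canon y.2 = Defs.canon y'.2 ->
  Psi_rep y = Psi_rep y'.
Proof.
move=> E1 /(canon_eq_prefix_exp hbar_gt0) E2; rewrite /Psi_rep E1; congr pair.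
by apply/rowP => i; rewrite !mxE E2.
Qed.

(** Any k with the right partial products may replace the lift made of differences of q. This
    applies in particular to a k obtained as a cluster point. *)
Lemma canon_Phi_rep x (k : 'rV[Zbar]_n) : bs_arr hbar x ->
  (forall i, prefix_exp hbar k i = 1 - x.1 0 i) ->
  Defs.canon (Phi_rep hbar x).2 = Defs.canon k.
Proof.
move=> Ax kE; apply/(canon_eq_prefix_exp hbar_gt0) => i.
by rewrite prefix_exp_Phi_rep // kE.
Qed.

Definition Psi (y : @sheu_tilde n) : bs_arr hbar :=
  SigSub (mem_set (Psi_repP (set_valP y))).

Definition Phi_inv (a : sheu_arr n) : bs_arr hbar := Psi (rep a).

Lemma Phi_inv_class (y : @sheu_tilde n) : Phi_inv (class y) = Psi y.
Proof.
have /class_arrP[E1 E2] : class (rep (class y : sheu_arr n)) =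
  class y :> sheu_arr n by rewrite repK.
by apply: val_inj; exact: Psi_rep_canon.
Qed.

Lemma PhiK : cancel (Phi hbar_gt0) Phi_inv.
Proof.
move=> x; rewrite /Phi Phi_inv_class; apply: val_inj => /=.
by rewrite Phi_repK //; exact: set_valP.
Qed.

Lemma Phi_Psi (y : @sheu_tilde n) : Phi hbar_gt0 (Psi y) = class y.
Proof.
apply/class_arrP; split; first exact: Phi_rep_Psi_rep1.
apply: canon_Phi_rep => [|i]; first exact: set_valP (Psi y).
by rewrite mxE subKr.
Qed.

Lemma Phi_invK : cancel Phi_inv (Phi hbar_gt0).
Proof. by move=> a; rewrite /Phi_inv Phi_Psi repK. Qed.

Lemma pdiff0 : pdiff 0 = 0 :> 'rV[int]_n.
Proof. by apply/rowP => i; rewrite !mxE subrr if_same. Qed.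

Lemma pdiffD (p p' : 'rV[int]_n) : pdiff (p + p') = pdiff p + pdiff p'.
Proof. by apply/rowP => i; rewrite !mxE; case: ifP => // _; ring. Qed.

Lemma Phi_rep_unit (c : 'rV[R]_n) :
  Phi_rep hbar (c, 0) = (0, qdiff (\row_i q_of hbar (c 0 i))).
Proof.
rewrite /Phi_rep /= -[in RHS]pdiff0; congr (pdiff _, _).
by apply/rowP => i; rewrite !mxE (p_of0 hbar_gt0).
Qed.

Lemma Phi_rep_dress x : bs_arr hbar x ->
  Phi_rep hbar (dress x.1 x.2, 0) =
  (0, translate (Phi_rep hbar x).1 (Phi_rep hbar x).2).
Proof.
move=> Ax; rewrite Phi_rep_unit translate_diff; congr (_, qdiff _).
apply/rowP => i; rewrite !mxE -[RHS]q_ofK; congr (q_of _ _).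
by rewrite -(dress_expNZ (bs_arr_q i Ax) (bs_arr_p i Ax)) mxE.
Qed.

Lemma Phi_rep_mul x (h : 'rV[R]_n) : bs_arr hbar x ->
  (forall i, in_hbarZ hbar (h 0 i)) ->
  Phi_rep hbar (x.1, x.2 + h) =
  ((Phi_rep hbar x).1 + pdiff (\row_i p_of hbar (h 0 i)), (Phi_rep hbar x).2).
Proof.
move=> Ax hZ; rewrite /Phi_rep /= -pdiffD; congr (pdiff _, _).
apply/rowP => i; rewrite !mxE (bs_arr_p _ Ax) (p_ofE (hZ i)).
by rewrite -mulrDr -intrD !p_ofK.
Qed.

(** Compatibility with sources is expressed on units, since the map on objects is only constructed
    afterwards, out of the map on arrows. *)
Lemma Phi_idt_src (x : arr (bs_groupoid n hbar)) :
  Phi hbar_gt0 (idt (src x)) = idt (src (Phi hbar_gt0 x)).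
Proof.
rewrite /= sheu_srcE sheu_idtE; congr class; apply: val_inj => /=.
by rewrite Phi_rep_unit.
Qed.

Lemma Phi_idt_tgt (x : arr (bs_groupoid n hbar)) :
  Phi hbar_gt0 (idt (tgt x)) = idt (tgt (Phi hbar_gt0 x)).
Proof.
rewrite /= sheu_tgtE sheu_idtE; congr class; apply: val_inj => /=.
by rewrite Phi_rep_dress //; exact: set_valP.
Qed.

Lemma Phi_mul (x y : arr (bs_groupoid n hbar)) : tgt x = src y ->
  Phi hbar_gt0 (Defs.mul x y) = Defs.mul (Phi hbar_gt0 x) (Phi hbar_gt0 y).
Proof.
move=> xy; have Ax := set_valP (x : bs_arr hbar).
have Ay := set_valP (y : bs_arr hbar).
have E : dress (val x).1 (val x).2 = (val y).1 by have /(congr1 val) := xy.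
(* The representatives [Phi_rep] of x and y are themselves composable, not merely up to equivalence,
   so the product can be computed on them. *)
rewrite /= sheu_mulE; last first.
  apply: val_inj => /=; have := Phi_rep_dress Ax.
  by rewrite E Phi_rep_unit => -[<-].
congr class; apply: val_inj; rewrite /= val_tilde_mul /=; last first.
  apply: val_inj => /=; have := Phi_rep_dress Ax.
  by rewrite E Phi_rep_unit => -[<-].
by rewrite val_bs_mul // Phi_rep_mul //; case: Ay.
Qed.

End Inverse.

(** * Continuity for products, rows, subspaces and quotients *)

Lemma continuous_pair (X Y Z : topologicalType) (f : X -> Y) (g : X -> Z) :
  continuous f -> continuous g -> continuous (fun x => (f x, g x)).
Proof. by move=> cf cg x; apply: cvg_pair; [exact: cf|exact: cg]. Qed.

Lemma continuous_entry (T : topologicalType) m n (i : 'I_m) (j : 'I_n) :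
  continuous (fun M : 'M[T]_(m, n) => M i j).
Proof.
(* The box constrains only the entry (i, j). *)
move=> M A MA; exists (fun i' j' => [set t | i' = i -> j' = j -> A t]).
  move=> i' j'; have [[-> ->]|ne] := pselect (i' = i /\ j' = j).
    by apply: filterS MA => t At _ _.
  by apply: filterE => t E1 E2; case: ne.
by move=> N /(_ i j) /(_ erefl erefl).
Qed.

Lemma continuous_row (X T : topologicalType) n (f : X -> 'rV[T]_n) :
  (forall i, continuous (fun x => f x 0 i)) -> continuous f.
Proof.
move=> cf x A [P fxP PA].
apply: (@filterS _ _ _ [set y | forall i, P 0 i (f y 0 i)]).
  by move=> y Py; apply: PA => i j; rewrite ord1.
by apply: filter_forall => i; apply: cf; exact: fxP.
Qed.

Lemma continuous_val (T : topologicalType) (A : set T) :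
  continuous (val : A -> T).
Proof. exact: initial_continuous. Qed.

Lemma continuous_in_sub (X T : topologicalType) (A : set T) (f : X -> A) :
  continuous (val \o f) -> continuous f.
Proof. exact: continuous_comp_initial. Qed.

Lemma continuous_class (T : topologicalType) (step : T -> T -> Prop) :
  continuous (class : T -> generated_quotient step).
Proof. exact: pi_continuous. Qed.

Lemma continuous_from_quotient (T U : topologicalType) (step : T -> T -> Prop)
    (f : generated_quotient step -> U) :
  continuous (f \o class) -> continuous f.
Proof. by move=> cf; apply/quotient_continuous. Qed.

(** * Topology of [Zbar] and Z^n, compactness, and continuity of the exponential *)

HB.instance Definition _ := Pointed.on Zbar.

Lemma nbhs_Zbar_None (A : set Zbar) :
  nbhs (None : Zbar) A <->
  A None /\ exists N : int, forall m : int, N <= m -> A (Some m).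
Proof.
split=> [AN|[AN AN']].
  split; first exact: nbhs_singleton AN.
  move: AN; rewrite nbhsE => -[U [oU UN] UA].
  by have [N NU] := oU UN; exists N => m /NU/UA.
by apply: (@open_nbhs_nbhs Zbar); split.
Qed.

Lemma nbhs_Zbar_Some (m : int) (A : set Zbar) :
  A (Some m) -> nbhs (Some m : Zbar) A.
Proof.
move=> Am; apply: (@filterS _ _ _ [set (Some m : Zbar)]); first by move=> _ ->.
by apply: (@open_nbhs_nbhs Zbar); split.
Qed.

(** An ultrafilter containing a singleton converges to its point. Otherwise it contains the
    complement of each singleton; removing 0, 1, 2, ... in turn shows that it contains every tail,
    so it converges to infinity. *)
Lemma compact_Zbar_ge0 : compact [set k : Zbar | Zbar_ge0 k].
Proof.
rewrite compact_ultra => F FU F0.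
have [[m Fm]|nF] := pselect (exists m : int, F [set (Some m : Zbar)]).
  have /filter_ex[_ [-> m0]] :
    F ([set (Some m : Zbar)] `&` [set k | Zbar_ge0 k]) by exact: filterI.
  exists (Some m); split=> // A /nbhs_singleton Am.
  by apply: filterS Fm => _ ->.
exists None; split=> // A /nbhs_Zbar_None[AN [N NA]].
suff FN (n : nat) : F [set k : Zbar | if k is Some m then n%:Z <= m else true].
  apply: filterS (FN `|N|%N) => -[m|//] /= Nm; apply: NA.
  exact: le_trans (ler_norm N) _.
elim: n => [|n IH]; first by apply: filterS F0 => -[].
have Fn : F (~` [set (Some n%:Z : Zbar)]).
  have [Fn|//] := in_ultra_setVsetC [set (Some n%:Z : Zbar)] FU.
  by case: nF; exists n%:Z.
apply: filterS (filterI IH Fn) => -[m|//] [/= nm mn].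
rewrite intS addrC lezD1 lt_neqAle nm andbT.
by apply/eqP => nm'; apply: mn; rewrite nm'.
Qed.

Lemma compact_Nbar n : compact (@Nbar n).
Proof. exact: (@rV_compact Zbar n (fun=> _) (fun=> compact_Zbar_ge0)). Qed.

Lemma continuous_expNZ (R : realType) (hbar : R) : 0 < hbar ->
  continuous (expNZ hbar).
Proof.
move=> hbar_gt0 [m|] A.
  by move=> /nbhs_singleton Am; exact: nbhs_Zbar_Some.
move=> /nbhs_ballP[e /= e0 eA]; apply/nbhs_Zbar_None.
split; first exact/eA/ballxx.
(* From this bound on, hbar m > - ln e, that is, e^(- hbar m) < e. *)
exists (Num.floor (- ln e / hbar) + 1) => m Nm; apply: eA.
rewrite /= /ball /= sub0r normrN ger0_norm ?expR_ge0 //.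
rewrite -[ltRHS](lnK e0) ltr_expR ltrNl -ltr_pdivrMl // mulrC.
by apply: lt_le_trans (floorD1_gt _) _; rewrite ler_int.
Qed.

Lemma continuous_prefix_exp (R : realType) (hbar : R) n (i : 'I_n) :
  0 < hbar -> continuous (fun k => prefix_exp hbar k i).
Proof.
move=> hbar_gt0; rewrite /prefix_exp.
apply: (@continuous_big R _ *%R 1 _ (@mul_continuous R) _ _
  (fun (m : 'I_n) (k : 'rV[Zbar]_n) => expNZ hbar (k 0 m))).
move=> m _ k; apply: (@continuous_comp _ _ _ (fun k : 'rV[Zbar]_n => k 0 m)).
  exact: continuous_entry.
exact: continuous_expNZ.
Qed.

Lemma nbhs_row_int n (j : 'rV[int]_n) (A : set 'rV[int]_n) : A j -> nbhs j A.
Proof.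
move=> Aj; exists (fun i l => [set j i l]).
  by move=> i l; rewrite nbhs_principalE; exact/principal_filterP.
by move=> j' jj'; suff -> : j' = j by []; apply/matrixP.
Qed.

Lemma continuous_row_int n (U : topologicalType) (f : 'rV[int]_n -> U) :
  continuous f.
Proof. by move=> j A /nbhs_singleton Aj; exact: nbhs_row_int. Qed.

(** * Continuity of the inverse *)

Lemma continuous_Psi (R : realType) (hbar : R) n (hbar_gt0 : 0 < hbar) :
  continuous (@Psi R n hbar hbar_gt0).
Proof.
apply: continuous_in_sub; apply: continuous_pair; apply: continuous_row => i.
  rewrite (_ : (fun x => _) = (fun x : @sheu_tilde n =>
    1 - prefix_exp hbar (val x).2 i)); last first.
    by apply/funext => x; rewrite mxE.
  move=> x; apply: continuousB; first exact: cst_continuous.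
  apply: (@continuous_comp _ _ _ (fun x : @sheu_tilde n => (val x).2)
    (fun k => prefix_exp hbar k i)).
    apply: continuous_comp; first exact: continuous_val.
    exact: cvg_snd.
  exact: continuous_prefix_exp.
rewrite (_ : (fun x => _) = fun x : @sheu_tilde n =>
  hbar * (\sum_(m < n | (m <= i)%N) (val x).1 0 m)%:~R); last first.
  by apply/funext => x; rewrite mxE.
move=> x; apply: (@continuous_comp _ _ _ (fun x : @sheu_tilde n => (val x).1)
  (fun j => hbar * (\sum_(m < n | (m <= i)%N) j 0 m)%:~R)).
  by apply: continuous_comp; [exact: continuous_val|exact: cvg_fst].
exact: continuous_row_int.
Qed.

Lemma continuous_Phi_inv (R : realType) (hbar : R) n (hbar_gt0 : 0 < hbar) :
  continuous (@Phi_inv R n hbar hbar_gt0).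
Proof.
apply: continuous_from_quotient.
rewrite (_ : _ \o _ = Psi hbar_gt0); first exact: continuous_Psi.
by apply/funext => y; exact: Phi_inv_class.
Qed.

(** * Continuity of [Phi] *)

Section PhiContinuous.
Variables (R : realType) (n : nat) (hbar : R).
Hypothesis hbar_gt0 : 0 < hbar.

Lemma continuous_bs_c (i : 'I_n) :
  continuous (fun x : @bs_arr R n hbar => (val x).1 0 i).
Proof.
move=> x; apply: (@continuous_comp _ _ _ (fun x : @bs_arr R n hbar => (val x).1)
  (fun c => c 0 i)); last exact: continuous_entry.
by apply: continuous_comp; [exact: continuous_val|exact: cvg_fst].
Qed.

Lemma continuous_bs_h (i : 'I_n) :
  continuous (fun x : @bs_arr R n hbar => (val x).2 0 i).
Proof.
move=> x; apply: (@continuous_comp _ _ _ (fun x : @bs_arr R n hbar => (val x).2)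
  (fun c => c 0 i)); last exact: continuous_entry.
by apply: continuous_comp; [exact: continuous_val|exact: cvg_snd].
Qed.

(** The entries of h lie in the lattice hbar Z, so two values at distance less than hbar
    coincide. *)
Lemma bs_h_locally_constant (x0 : @bs_arr R n hbar) :
  nbhs x0 [set x : @bs_arr R n hbar | (val x).2 = (val x0).2].
Proof.
suff : nbhs x0 [set x : @bs_arr R n hbar |
    forall i, (val x).2 0 i = (val x0).2 0 i].
  by apply: filterS => x E; apply/rowP.
apply: (@filter_forall (@bs_arr R n hbar) 'I_n
  (fun i x => (val x).2 0 i = (val x0).2 0 i) (nbhs x0)) => i.
have /cvgrPdist_lt/(_ hbar hbar_gt0) := @continuous_bs_h i x0.
apply: filterS => x /=.
have [p ->] : in_hbarZ hbar ((val x).2 0 i) by case: (set_valP x).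
have [p0 ->] : in_hbarZ hbar ((val x0).2 0 i) by case: (set_valP x0).
rewrite -mulrBr -intrB normrM gtr0_norm // gtr_pMr // -intr_norm ltrz1.
rewrite -[1]add0r ltzD1 normr_le0 subr_eq0 => /eqP -> //.
Qed.

Lemma continuous_Phi :
  continuous (Phi hbar_gt0 : @bs_arr R n hbar -> sheu_arr n).
Proof.
move=> x0 V PhiV; apply: contrapT => nV.
(* If [Phi] fails to be continuous at [x0], the points sent outside V accumulate at [x0], so this
   trace of the neighbourhood filter is proper. *)
pose W := within (~` (Phi hbar_gt0 @^-1` V)) (nbhs x0).
have WP : ProperFilter W.
  apply: Build_ProperFilter_ex => A WA; apply: contrapT => A0; apply: nV.
  apply: (@filterS _ (nbhs x0) _ _ _ _ WA) => x Ax.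
  by apply: contrapT => nVx; apply: A0; exists x; exact: Ax.
pose lift_k (x : @bs_arr R n hbar) := (Phi_rep hbar (val x)).2.
have [|k [k0 kcl]] := @compact_Nbar n (lift_k @ W) _.
  by apply: (@filterE _ W) => x; case: (Phi_repP hbar_gt0 (set_valP x)) => -[].
(* Near [x0] the lifts have partial products 1 - c_i close to the value at [x0], and some of these
   lifts are close to k; each approximation costs e / 2. *)
have kE i : prefix_exp hbar k i = 1 - (val x0).1 0 i.
  apply/eqP; rewrite -subr_eq0 -normr_eq0.
  apply/eqP/le_anti; rewrite normr_ge0 andbT.
  apply/ler_addgt0Pl => e e0; rewrite addr0.
  have e20 : 0 < e / 2 by rewrite divr_gt0.
  have /cvgrPdist_lt/(_ _ e20) B :=
    @continuous_prefix_exp R hbar n i hbar_gt0 k.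
  have /cvgrPdist_lt/(_ _ e20) A := @continuous_bs_c i x0.
  pose N := [set x : @bs_arr R n hbar |
    `|(val x0).1 0 i - (val x).1 0 i| < e / 2].
  have WN : (lift_k @ W) (lift_k @` N).
    by apply: (@filterS _ (nbhs x0) _ _ _ _ A) => x Nx _; exists x.
  have [_ [[x Nx <-] /= Bx]] := kcl _ _ WN B.
  rewrite (prefix_exp_Phi_rep hbar_gt0 i (set_valP x)) in Bx.
  rewrite (_ : _ - _ = (prefix_exp hbar k i - (1 - (val x).1 0 i)) +
    ((val x0).1 0 i - (val x).1 0 i)); last by ring.
  apply: le_trans (ler_normD _ _) _; rewrite [e]splitr; apply: lerD; exact: ltW.
have cE := canon_Phi_rep hbar_gt0 (set_valP x0) kE.
have yP : sheu_tilde ((Phi_rep hbar (val x0)).1, k).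
  apply: tilde_canon (Phi_repP hbar_gt0 (set_valP x0)) _ cE.
  exact: k0.
pose y : @sheu_tilde n := SigSub (mem_set yP).
(* The class of (j, k) is [Phi x0], so V pulls back to a neighbourhood of (j, k) in [sheu_tilde],
   which contains the trace of a box [A1] x [A2]. *)
have /continuous_class : nbhs (class y : sheu_arr n) V.
  suff <- : Phi hbar_gt0 x0 = class y by [].
  exact/class_arrP.
move=> [_ [[B oB <-] By] BV]; move: oB; rewrite openE => /(_ _ By).
move=> [[A1 A2] [/= /nbhs_singleton A1j A2k] A12].
have WH : (lift_k @ W) (lift_k @` [set x | (val x).2 = (val x0).2 /\
    ~ V (Phi hbar_gt0 x)]).
  apply: (@filterS _ (nbhs x0) _ _ _ _ (bs_h_locally_constant x0)).
  by move=> x E nVx; exists x.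
(* Since k is a cluster point, some x sent outside V has its lift in [A2]. Its h is that of [x0], so
   its j is too; the whole lift is then in the box, which puts [Phi x] in V. *)
have [_ [[x [E nVx] <-] A2x]] := kcl _ _ WH A2k.
apply/nVx/BV; apply: A12; split=> //=.
by rewrite E.
Qed.

End PhiContinuous.

(** * Transport of a topological groupoid structure along a homeomorphism of arrows *)

Section Transfer.
Variables (G H : groupoid) (F : arr G -> arr H) (F' : arr H -> arr G).
Hypothesis G_top : is_topological G.
Hypothesis src_H_continuous : continuous (@src H).
Hypothesis idt_H_continuous : continuous (@idt H).
Hypothesis F_continuous : continuous F.
Hypothesis F'_continuous : continuous F'.
Hypothesis FK : cancel F F'.
Hypothesis F'K : cancel F' F.
Hypothesis F_idt_src : forall f, F (idt (src f)) = idt (src (F f)).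
Hypothesis F_idt_tgt : forall f, F (idt (tgt f)) = idt (tgt (F f)).
Hypothesis F_mul : forall f g, tgt f = src g ->
  F (Defs.mul f g) = Defs.mul (F f) (F g).

(** Objects are identified with their units, so the maps on arrows determine those on objects. *)
Let F0 (a : ob G) : ob H := src (F (idt a)).
Let F0' (b : ob H) : ob G := src (F' (idt b)).

Let F0_src f : F0 (src f) = src (F f).
Proof. by rewrite /F0 F_idt_src (src_idt (laws H)). Qed.

Let F0_tgt f : F0 (tgt f) = tgt (F f).
Proof. by rewrite /F0 F_idt_tgt (src_idt (laws H)). Qed.

Let F0_idt a : F (idt a) = idt (F0 a).
Proof. by rewrite -F_idt_src (src_idt (laws G)). Qed.

Let F0K : cancel F0 F0'.
Proof. by move=> a; rewrite /F0' -F0_idt FK (src_idt (laws G)). Qed.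

Let F0'K : cancel F0' F0.
Proof. by move=> b; rewrite /F0' F0_src F'K (src_idt (laws H)). Qed.

Let F0_continuous : continuous F0.
Proof.
move=> a; apply: (@continuous_comp _ _ _ (F \o idt)).
  by apply: continuous_comp; [exact: idt_continuous|exact: F_continuous].
exact: src_H_continuous.
Qed.

Let F0'_continuous : continuous F0'.
Proof.
move=> b; apply: (@continuous_comp _ _ _ (F' \o idt)).
  by apply: continuous_comp; [exact: idt_H_continuous|exact: F'_continuous].
exact: src_continuous.
Qed.

(** A right inverse in a groupoid is the inverse: [F f] times [F (inv f)] is a unit, and multiplying
    on the left by [inv (F f)] gives the claim. *)
Let F_inv f : F (Defs.inv f) = Defs.inv (F f).
Proof.
have [LG LH] := (laws G, laws H).
have Fff : Defs.mul (F f) (F (Defs.inv f)) = idt (src (F f)).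
  by rewrite -F_mul ?(src_inv LG) // (mul_invr LG) F_idt_src.
have E : src (F (Defs.inv f)) = tgt (F f).
  by rewrite -F0_src (src_inv LG) F0_tgt.
rewrite -[LHS](mul_idl LH) E -(mul_invl LH) -(mul_assoc LH) ?(tgt_inv LH) //.
by rewrite Fff -(tgt_inv LH) (mul_idr LH).
Qed.

(** Equality of objects of G can be tested after applying the injective [F0]. *)
Let F'_composable (fg : @composable H) :
  @composable G (F' (val fg).1, F' (val fg).2).
Proof.
have /= E := set_valP fg; apply: (can_inj F0K).
by rewrite F0_tgt F0_src !F'K.
Qed.

Let F'_pair (fg : @composable H) : @composable G :=
  SigSub (mem_set (F'_composable fg)).

Let F'_pair_continuous : continuous F'_pair.
Proof.
apply: continuous_in_sub; apply: continuous_pair => fg.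
  apply: (@continuous_comp _ _ _ (fun fg : @composable H => (val fg).1)).
    by apply: continuous_comp; [exact: continuous_val|exact: cvg_fst].
  exact: F'_continuous.
apply: (@continuous_comp _ _ _ (fun fg : @composable H => (val fg).2)).
  by apply: continuous_comp; [exact: continuous_val|exact: cvg_snd].
exact: F'_continuous.
Qed.

(** Continuity of the source and unit maps of H makes [F0] a homeomorphism. The target, inverse and
    product of H are then conjugates of those of G, hence continuous. For a quotient groupoid this
    avoids a direct study of composable pairs of classes. *)
Lemma iso_of_arrow_homeomorphism : is_topological_groupoid_iso F.
Proof.
split=> //; last first.
  exists F0; split.
  - by split=> //; move=> f; rewrite (F0_src, F0_tgt).
  - by split=> //; exists F0'.
  - by split=> //; exists F'.
split=> //.
- rewrite (_ : tgt = F0 \o tgt \o F'); last first.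
    by apply/funext => a; rewrite /= F0_tgt F'K.
  move=> a; apply: continuous_comp; first exact: F'_continuous.
  by apply: continuous_comp; [exact: tgt_continuous|exact: F0_continuous].
- rewrite (_ : Defs.inv = F \o Defs.inv \o F'); last first.
    by apply/funext => a; rewrite /= F_inv F'K.
  move=> a; apply: continuous_comp; first exact: F'_continuous.
  by apply: continuous_comp; [exact: Defs.inv_continuous|exact: F_continuous].
apply/subspace_sigL_continuousP.
have /subspace_sigL_continuousP mulG := Defs.mul_continuous G_top.
rewrite (_ : sigL _ _ = F \o sigL _ (fun fg => Defs.mul fg.1 fg.2) \o F'_pair).
  move=> a; apply: continuous_comp; first exact: F'_pair_continuous.
  by apply: continuous_comp; [exact: mulG|exact: F_continuous].
apply/funext => fg; rewrite /= /sigL /= F_mul ?F'K //.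
exact: F'_composable fg.
Qed.

End Transfer.

(** * Source and unit maps of Sheu's groupoid *)

Section SheuContinuous.
Variable n : nat.

Lemma sheu_src_continuous : continuous (@sheu_src n).
Proof.
apply: continuous_from_quotient.
rewrite (_ : _ \o _ = class \o @tilde_src n); last first.
  by apply/funext => x; exact: sheu_srcE.
move=> x; apply: continuous_comp; last exact: continuous_class.
apply: (@continuous_in_sub (@sheu_tilde n) 'rV[Zbar]_n (@Nbar n)) => {}x.
by apply: continuous_comp; [exact: continuous_val|exact: cvg_snd].
Qed.

Lemma sheu_idt_continuous : continuous (@sheu_idt n).
Proof.
apply: continuous_from_quotient.
rewrite (_ : _ \o _ = class \o @tilde_idt n); last first.
  by apply/funext => x; exact: sheu_idtE.
move=> x; apply: continuous_comp; last exact: continuous_class.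
apply: continuous_in_sub; apply: continuous_pair; first exact: cst_continuous.
exact: continuous_val.
Qed.

End SheuContinuous.

(** * The Bohr-Sommerfeld groupoid is topological *)

Section BohrSommerfeldContinuous.
Variables (R : realType) (n : nat) (hbar : R).

Lemma bs_src_continuous : continuous (@bs_src R n hbar).
Proof.
apply: (@continuous_in_sub (@bs_arr R n hbar) 'rV[R]_n (@bs_ob R n hbar)) => x.
by apply: continuous_comp; [exact: continuous_val|exact: cvg_fst].
Qed.

Lemma dress_continuous :
  continuous (fun x : @bs_arr R n hbar => dress (val x).1 (val x).2).
Proof.
apply: continuous_row => i.
rewrite (_ : (fun x => _) = (fun x : @bs_arr R n hbar =>
  1 + expR (- (val x).2 0 i) * ((val x).1 0 i - 1))); last first.
  by apply/funext => x; rewrite mxE.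
move=> x; apply: (@continuousD R R _ (fun=> 1) (fun x : @bs_arr R n hbar =>
  expR (- (val x).2 0 i) * ((val x).1 0 i - 1))); first exact: cst_continuous.
apply: continuousM.
  apply: (@continuous_comp _ _ _ (fun x : @bs_arr R n hbar => - (val x).2 0 i)).
    by apply: continuousN; exact: continuous_bs_h.
  exact: continuous_expR.
by apply: continuousB; [exact: continuous_bs_c|exact: cst_continuous].
Qed.

Lemma bs_topological : is_topological (bs_groupoid n hbar).
Proof.
split.
- exact: bs_src_continuous.
- apply: (@continuous_in_sub (@bs_arr R n hbar) 'rV[R]_n (@bs_ob R n hbar)).
  exact: dress_continuous.
- apply: (@continuous_in_sub (@bs_ob R n hbar) _ (@bs_arr R n hbar)).
  apply: continuous_pair; first exact: continuous_val.
  exact: cst_continuous.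
- apply: (@continuous_in_sub (@bs_arr R n hbar) _ (@bs_arr R n hbar)).
  apply: continuous_pair; first exact: dress_continuous.
  apply: continuous_row => i.
  rewrite (_ : (fun x => _) = (fun x : @bs_arr R n hbar => - (val x).2 0 i)).
    by move=> x; apply: continuousN; exact: continuous_bs_h.
  by apply/funext => x; rewrite mxE.
apply/subspace_sigL_continuousP.
pose C := @composable (bs_groupoid n hbar).
apply: (@continuous_in_sub C _ (@bs_arr R n hbar)).
have c1 : continuous (fun fg : C => (val fg).1).
  by move=> fg; apply: continuous_comp; [exact: continuous_val|exact: cvg_fst].
have c2 : continuous (fun fg : C => (val fg).2).
  by move=> fg; apply: continuous_comp; [exact: continuous_val|exact: cvg_snd].
(* On composable pairs [bs_mul] takes the value (c, h + h') and not its default. *)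
rewrite (_ : _ \o _ = (fun fg : C => ((val (val fg).1).1,
    (val (val fg).1).2 + (val (val fg).2).2))); last first.
  by apply/funext => fg; rewrite /= /sigL /= val_bs_mul //; exact: set_valP fg.
apply: continuous_pair.
  move=> fg; apply: (@continuous_comp _ _ _ (fun fg : C => (val fg).1)
    (fun x : @bs_arr R n hbar => (val x).1)); first exact: c1.
  by apply: continuous_comp; [exact: continuous_val|exact: cvg_fst].
apply: continuous_row => i.
rewrite (_ : (fun x => _) = (fun fg : C =>
    (val (val fg).1).2 0 i + (val (val fg).2).2 0 i)); last first.
  by apply/funext => fg; rewrite mxE.
move=> fg; apply: continuousD.
  apply: (@continuous_comp _ _ _ (fun fg : C => (val fg).1)
    (fun x : @bs_arr R n hbar => (val x).2 0 i)); first exact: c1.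
  exact: continuous_bs_h.
apply: (@continuous_comp _ _ _ (fun fg : C => (val fg).2)
    (fun x : @bs_arr R n hbar => (val x).2 0 i)); first exact: c2.
exact: continuous_bs_h.
Qed.

End BohrSommerfeldContinuous.

Theorem proposition7p1 (R : realType) (n : nat) (n_gt0 : (1 <= n)%N)
    (hbar : R) (hbar_gt0 : 0 < hbar) :
  @is_topological_groupoid_iso (bs_groupoid n hbar) (sheu_groupoid n)
    (@Phi R n hbar hbar_gt0).
Proof.
apply: (@iso_of_arrow_homeomorphism (bs_groupoid n hbar) (sheu_groupoid n)
  (Phi hbar_gt0) (@Phi_inv R n hbar hbar_gt0)).
- exact: bs_topological.
- exact: sheu_src_continuous.
- exact: sheu_idt_continuous.
- exact: continuous_Phi.
- exact: continuous_Phi_inv.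
- exact: PhiK.
- exact: Phi_invK.
- exact: Phi_idt_src.
- exact: Phi_idt_tgt.
- exact: Phi_mul.
Qed.
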